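(* Let $f:[a;b]\to\mathbb{R}$ be a càdlàg function, $c>0$, and let $f^c:[a;b]\to\mathbb{R}$ be the function constructed from $f$ and $c$ in the context. If $g:[a;b]\to\mathbb{R}$ is such that $\|f-g\|_\infty\le c/2$ and $g$ has finite total variation, then for every $s\in[a;b]$ $$TV(g,[a;s])\ge TV(f^c,[a;s]).$$ Moreover, $f^c$ is unique in the following sense: if, in addition, for every $s\in[a;b]$ the opposite inequality $TV(g,[a;s])\le TV(f^c,[a;s])$ holds and $c\le\sup_{s,u\in[a;b]}|f(s)-f(u)|$, then $g=f^c$.
   Context: Let $-\infty<a<b<+\infty$; $\|h\|_\infty=\sup_{s\in[a;b]}|h(s)|$; $TV(g,[a;s])=\sup_n\sup_{a\le t_0<\dots<t_n\le s}\sum_{i=1}^n|g(t_i)-g(t_{i-1})|$ (equal to $0$ for $s=a$). Construction of $f^c$ (with $\inf\emptyset=\infty$). Let $T_D^cf=\inf\{s\in[a;b]:\sup_{t\in[a;s]}f(t)-f(s)\ge c\}$ and $T_U^cf=\inf\{s\in[a;b]:f(s)-\inf_{t\in[a;s]}f(t)\ge c\}$. Case $T_D^cf\ge T_U^cf$ (including both infinite). Put $T_{D,-1}^c=a$, $T_{U,0}^c=T_U^cf$ and for $k=0,1,2,\dots$: $T_{D,k}^c=\inf\{s\in[T_{U,k}^c;b]:\sup_{t\in[T_{U,k}^c;s]}f(t)-f(s)\ge c\}$ if $T_{U,k}^c<b$, and $T_{D,k}^c=\infty$ if $T_{U,k}^c\ge b$; $T_{U,k+1}^c=\inf\{s\in[T_{D,k}^c;b]:f(s)-\inf_{t\in[T_{D,k}^c;s]}f(t)\ge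 c\}$ if $T_{D,k}^c<b$, and $T_{U,k+1}^c=\infty$ if $T_{D,k}^c\ge b$. (Only finitely many of these times are finite.) Define $f^c(s)=\inf_{t\in[a;T_{U,0}^c)\cap[a;b]}f(t)+c/2$ for $s\in[a;T_{U,0}^c)\cap[a;b]$; $f^c(s)=\sup_{t\in[T_{U,k}^c;s]}f(t)-c/2$ for $s\in[T_{U,k}^c;T_{D,k}^c)\cap[a;b]$; $f^c(s)=\inf_{t\in[T_{D,k}^c;s]}f(t)+c/2$ for $s\in[T_{D,k}^c;T_{U,k+1}^c)\cap[a;b]$ ($k=0,1,2,\dots$). Case $T_D^cf<T_U^cf$: $f^c=-(-f)^c$. *)

(* Defs.v *)
From HB Require Import structures.
From mathcomp Require Import all_boot all_order all_algebra.
From mathcomp Require Import all_classical all_reals all_analysis.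
Set Implicit Arguments.
Unset Strict Implicit.
Unset Printing Implicit Defensive.
Import Order.TTheory GRing.Theory Num.Theory.
Import numFieldNormedType.Exports.
Local Open Scope classical_set_scope.
Local Open Scope ring_scope.

(* A function on [a; b] is represented by a total function R -> R; nothing
   below depends on its values outside [a; b]. *)

Section defs.
Context {R : realType}.
Implicit Types (a b c s t y : R) (f h : R -> R) (T : \bar R).

Definition cadlag a b f : Prop :=
  (forall s, a <= s < b -> f t @[t --> s^'+] --> f s) /\
  (forall s, a < s <= b -> cvg (f t @[t --> s^'-])).

Definition sup_norm a b h : \bar R :=
  ereal_sup [set `|h s|%:E | s in `[a, b]].

Definition oscillation a b f : \bar R :=
  ereal_sup [set `|f x.1 - f x.2|%:E | x in `[a, b] `*` `[a, b]].

(* Stopping times take values in \bar R, where ereal_inf set0 = +oo.  Suprema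
   and infima of f are the real-valued sup and inf: a cadlag function is
   bounded on [a; b], and the sets they are taken over are nonempty wherever
   their values are used. *)

Definition sup_from f T s : R := sup [set f t | t in [set t | (T <= t%:E)%E /\ t <= s]].

Definition inf_from f T s : R := inf [set f t | t in [set t | (T <= t%:E)%E /\ t <= s]].

Definition drop_time b c f T : \bar R :=
  ereal_inf [set s%:E | s in
    [set s | [/\ (T <= s%:E)%E, s <= b & c <= sup_from f T s - f s]]].

Definition rise_time b c f T : \bar R :=
  ereal_inf [set s%:E | s in
    [set s | [/\ (T <= s%:E)%E, s <= b & c <= f s - inf_from f T s]]].

Definition next_drop b c f T : \bar R :=
  if (T < b%:E)%E then drop_time b c f T else +oo%E.

Definition next_rise b c f T : \bar R :=
  if (T < b%:E)%E then rise_time b c f T else +oo%E.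

Fixpoint TU a b c f (k : nat) : \bar R :=
  if k is k'.+1 then next_rise b c f (next_drop b c f (TU a b c f k'))
  else rise_time b c f a%:E.

Definition TD a b c f (k : nat) : \bar R := next_drop b c f (TU a b c f k).

(* [fc_piece a b c f s y] : one of the clauses of the piecewise definition of
   f^c (in the case T_D f >= T_U f) applies to s and gives it the value y.  For
   a cadlag f the intervals of these clauses partition [a; b]. *)
Definition fc_piece a b c f s y : Prop :=
  [\/ (s%:E < TU a b c f 0)%E /\
        y = inf [set f t | t in [set t | a <= t <= b /\ (t%:E < TU a b c f 0)%E]]
            + c / 2,
      exists k, (TU a b c f k <= s%:E < TD a b c f k)%E /\
        y = sup_from f (TU a b c f k) s - c / 2 |
      exists k, (TD a b c f k <= s%:E < TU a b c f k.+1)%E /\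
        y = inf_from f (TD a b c f k) s + c / 2].

Definition fc_up a b c f s : R := xget 0 [set y | fc_piece a b c f s y].

Definition fc a b c f : R -> R :=
  if (rise_time b c f a%:E <= drop_time b c f a%:E)%E then fc_up a b c f
  else \- fc_up a b c (\- f).

End defs.

(* Main.v *)
Require Import Defs.
From HB Require Import structures.
From mathcomp Require Import all_boot all_order all_algebra.
From mathcomp Require Import all_classical all_reals all_analysis.
From mathcomp Require Import lra.
Import Order.TTheory GRing.Theory Num.Theory.
Import numFieldNormedType.Exports.
Local Open Scope classical_set_scope.
Local Open Scope ring_scope.

Set Implicit Arguments.
Unset Strict Implicit.
Unset Printing Implicit Defensive.

(** Write [h] for [f^c], [W s] for the total variation of [g] on [[a; s]] and
    [V s] for that of [h].

    The switching times T_{U,0} < T_{D,0} < T_{U,1} < ... cut [[a; b]] into an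
    initial piece, on which [h] is constant, and phases.  Replacing [f], [g], [h]
    by their negatives in every other phase ([alt]), each phase looks the same:
    it starts at some [x], on it [h s] is the running supremum of [f] from [x]
    minus [c / 2], hence nondecreasing, and it ends at the first time [f] has
    dropped by [c] below that supremum.

    Both [W - g] and [W + g] are nondecreasing.  The invariant carried from phase
    to phase ([certificate]) is a number [B] that lies between the corresponding
    quantities for [h] and [g]: [V - h <= B] at [x], and [B <= W - g] from [x]
    on.  Within the phase [V - h] is constant, while [g >= f - c / 2] makes [g]
    come, before [s], at least arbitrarily close to [h s]; hence
    [V s <= B + h s <= W s] ([phase_total_variation], [phase_le_controller]).
    At the end [y] of the phase the roles of [V - h] and [V + h] are exchanged:
    if [m] is the supremum of [h] over the phase, then [h] climbs to [m] and
    jumps down, so [V + h <= B + 2 m] at [y], and [W + g >= B + 2 m] from [y] on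
    because [g] has been near [m] or above it ([certificate_at_drop]).

    If moreover [W s <= V s], then [W s = B + h s].  Together with [B <= W - g]
    this gives [g s <= h s], and the converse inequality follows because [g] has
    been near [h s] or above it before [s] and [W] has too little left to spend
    for a way back ([phase_unique]).  On the initial piece [W = 0], so [g] is
    constant; its value is forced by the first jump of [h], or, if there is no
    switching time at all, by the oscillation of [f] being at least [c].

    The times and phases are well behaved because [f] is bounded, being within
    [c / 2] of a function of bounded variation: right continuity makes every
    finite switching time attained ([drop_time_attained]), and left limits
    prevent infinitely many of them from accumulating ([phase_cover]).  The case
    distinction in the definition of [f^c] only selects whether the argument is
    applied to [f] or to [- f]. *)

(** * Upper bounds for the total variation *)

Section total_variation_bounds.
Context {R : realType}.
Implicit Types (x y m : R) (h phi : R -> R).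

(** [h] is the difference of the nondecreasing functions [(phi + h) / 2] and
    [(phi - h) / 2], whose variations add up to that of [phi]. *)
Lemma total_variation_le_potential x y h phi : x <= y ->
  {in `[x, y] &, nondecreasing_fun (phi \+ h)} ->
  {in `[x, y] &, nondecreasing_fun (phi \- h)} ->
  (total_variation x y h <= (phi y - phi x)%:E)%E.
Proof.
move=> xy up down.
pose p t := (phi t + h t) / 2; pose q t := (phi t - h t) / 2.
have -> : h = p \+ (\- q).
  by apply/funext => t; rewrite /p /q /=; lra.
apply: (le_trans (total_variation_le _ _ xy)).
rewrite total_variationN !nondecreasing_total_variation //.
- by rewrite -EFinD lee_fin /p /q; lra.
- by move=> s t sxy txy st; move: (down s t sxy txy st); rewrite /q /=; lra.
- by move=> s t sxy txy st; move: (up s t sxy txy st); rewrite /p /=; lra.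
Qed.

(** The worst case is to climb from [h x] to [m] and then to jump from [m] down
    to [h y].  The level [m] stands for the left limit of [h] at [y], which [h] may
    approach without reaching it. *)
Lemma total_variation_peak x y m h : x < y ->
  (forall s t, x <= s -> s <= t -> t < y -> h s <= h t) ->
  (forall s, x <= s -> s <= y -> h s <= m) ->
  (total_variation x y h <= (2 * m - h x - h y)%:E)%E.
Proof.
move=> xy incr hm.
(* the variation of the climb, completed by that of the final jump *)
pose phi t := if t < y then h t else 2 * m - h y.
have -> : 2 * m - h x - h y = phi y - phi x.
  by rewrite /phi ltxx xy; lra.
apply: total_variation_le_potential; first exact: ltW.
all: move=> s t; rewrite !in_itv/= => /andP[xs sy] /andP[xt ty] st; rewrite /phi.
all: have := hm _ xs sy; have := hm _ xt ty; have := incr _ _ xs st.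
all: case: ltP => [sy'|ys]; case: ltP => [ty'|yt].
all: try (have -> : t = y by lra).
all: try (have -> : s = y by lra).
all: move=> // I J K; try have := I isT; lra.
Qed.

End total_variation_bounds.

(** * Attainment of the switching times *)

Section drop_times.
Context {R : realType}.
Implicit Types (a b c x y s t m M : R) (F f : R -> R) (T : \bar R).

Lemma sup_from_ge b F M x s t : (forall u, x <= u <= b -> F u <= M) ->
  x <= t <= s -> s <= b -> F t <= sup_from F x%:E s.
Proof.
move=> FM /andP[xt ts] sb; apply: ub_le_sup.
  exists M => _ [u /= [xu us] <-]; apply: FM.
  by rewrite -lee_fin xu (le_trans us).
by exists t => //=; rewrite lee_fin.
Qed.

Lemma sup_from_le F m x s : x <= s ->
  (forall t, x <= t <= s -> F t <= m) -> sup_from F x%:E s <= m.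
Proof.
move=> xs Fm; apply: ge_sup.
  by exists (F s), s => //=; rewrite lee_fin.
by move=> _ [t /= [xt ts] <-]; apply: Fm; rewrite -lee_fin xt.
Qed.

Lemma sup_from_self F y : sup_from F y%:E y = F y.
Proof.
apply/eqP; rewrite eq_le; apply/andP; split.
  by apply: sup_from_le => // t /andP[? ?]; have -> : t = y by lra.
apply: (@sup_from_ge y F (F y)); rewrite ?lexx// => u /andP[? ?].
by have -> : u = y by lra.
Qed.

Lemma inf_from_sup_from F T s : inf_from F T s = - sup_from (\- F) T s.
Proof.
rewrite /inf_from /sup_from /inf; congr (- sup _).
by rewrite image_comp.
Qed.

Lemma rise_timeE b c F T : rise_time b c F T = drop_time b c (\- F) T.
Proof.
rewrite /rise_time /drop_time; congr (ereal_inf [set s%:E | s in _]).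
by apply/funext => s; rewrite /= inf_from_sup_from !opprK [F s + _]addrC.
Qed.

Lemma next_riseE b c F T : next_rise b c F T = next_drop b c (\- F) T.
Proof. by rewrite /next_rise /next_drop rise_timeE. Qed.

Lemma drop_time_ge b c F T : (T <= drop_time b c F T)%E.
Proof. by apply: le_ereal_inf_tmp => _ [s /= [Ts _ _] <-]. Qed.

Lemma next_drop_ge b c F T : (T <= next_drop b c F T)%E.
Proof. by rewrite /next_drop; case: ifP => _; [exact: drop_time_ge|rewrite leey]. Qed.

(** Otherwise the drop at [y := drop_time b c F x] is smaller than [c] by a
    positive margin.  By right continuity [F], and hence its running supremum,
    changes by less than that margin shortly after [y], so the drop stays
    below [c] there and the infimum is larger than [y]. *)
Lemma drop_time_attained b c F M x : 0 < c -> x <= b ->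
  (forall u, x <= u <= b -> F u <= M) ->
  (forall s, x <= s < b -> F t @[t --> s^'+] --> F s) ->
  (drop_time b c F x%:E < +oo)%E ->
  exists y, [/\ drop_time b c F x%:E = y%:E, x < y, y <= b
              & c <= sup_from F x%:E y - F y].
Proof.
move=> c0 xb FM Frc fin.
have /ereal_inf_lt[_ /= [s0 [xs0 s0b _] <-] _] := fin.
have lb := drop_time_ge b c F x%:E.
have Tb : (drop_time b c F x%:E <= b%:E)%E.
  have [_ [s [xs sb cs] <-] _] := ereal_inf_lt fin.
  by apply: (@le_trans _ _ s%:E); [apply: ereal_inf_lbound; exists s|rewrite lee_fin].
case E : (drop_time b c F x%:E) lb Tb => [y| |] //.
rewrite !lee_fin => xy yb; exists y.
suff H : c <= sup_from F x%:E y - F y.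
  split=> //; rewrite lt_neqAle xy andbT; apply/eqP => xE; subst x.
  by move: H; rewrite sup_from_self; lra.
rewrite leNgt; apply/negP => lt_c.
(* keeps the drop below [c] whether the running supremum is still that of
   [x, y] or has been renewed after [y] *)
pose d := Num.min c (c - (sup_from F x%:E y - F y)) / 3.
have d0 : 0 < d by rewrite divr_gt0// lt_min c0 subr_gt0.
have dc : 3 * d <= c.
  have : Num.min c (c - (sup_from F x%:E y - F y)) <= c by rewrite ge_min lexx.
  by rewrite /d; lra.
have dD : 3 * d <= c - (sup_from F x%:E y - F y).
  have : Num.min c (c - (sup_from F x%:E y - F y)) <= c - (sup_from F x%:E y - F y).
    by rewrite ge_min lexx orbT.
  by rewrite /d; lra.
have [r r0 near_y] : exists2 r, 0 < r &
    forall t, y <= t -> t <= b -> t < y + r -> `|F t - F y| < d.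
  have [yb'|by_] := ltP y b; last first.
    exists 1 => // t yt tb _; have -> : t = y by lra.
    by rewrite subrr normr0.
  have /cvgrPdist_lt/(_ d d0) : F t @[t --> y^'+] --> F y.
    by apply: Frc; rewrite xy.
  rewrite near_withinE => /nbhs_ballP[r /= r0 H]; exists r => // t yt tb tr.
  have [->|ty] := eqVneq t y; first by rewrite subrr normr0.
  rewrite distrC; apply: H.
    by rewrite /ball /= distrC ger0_norm; lra.
  by rewrite lt_neqAle eq_sym ty.
have : (drop_time b c F x%:E < (y + r)%:E)%E by rewrite E lte_fin; lra.
case/ereal_inf_lt => _ [s /= [xs sb cs] <-]; rewrite lte_fin => sr.
have ys : y <= s.
  by rewrite -lee_fin -E; apply: ereal_inf_lbound; exists s.
have Fs := near_y _ ys sb sr.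
have : sup_from F x%:E s <= Num.max (sup_from F x%:E y) (F y + d).
  apply: sup_from_le => [|t /andP[xt ts]]; first by lra.
  rewrite le_max; have [ty|yt] := leP t y.
    by rewrite (@sup_from_ge b F M) ?xt.
  have := near_y t (ltW yt) (le_trans ts sb) (le_lt_trans ts sr).
  rewrite ltr_norml => /andP[_ ?]; apply/orP; right; lra.
move: Fs; rewrite ltr_norml le_max => /andP[? ?] /orP[]; lra.
Qed.

Lemma next_drop_attained b c F M x : 0 < c ->
  (forall u, x <= u <= b -> F u <= M) ->
  (forall s, x <= s < b -> F t @[t --> s^'+] --> F s) ->
  (next_drop b c F x%:E < +oo)%E ->
  exists y, [/\ next_drop b c F x%:E = y%:E, x < y, y <= b
              & c <= sup_from F x%:E y - F y].
Proof.
rewrite /next_drop; case: ifPn => // xb c0; apply: drop_time_attained => //.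
by rewrite ltW// -lte_fin.
Qed.

End drop_times.

(** * The switching times as one alternating sequence *)

Section alternation.
Context {R : realType}.
Implicit Types (a b c s t x y : R) (f : R -> R).

(** A rise of [f] is a drop of [- f], so with this sign every phase, rising or
    falling, obeys one and the same description in terms of suprema and drops. *)
Definition alt n f : R -> R := fun t => (-1) ^+ n * f t.

Lemma altS n f : alt n.+1 f = \- alt n f.
Proof. by apply/funext => t; rewrite /alt exprS mulN1r mulNr. Qed.

Lemma alt_double k f : alt k.*2 f = f.
Proof. by apply/funext => t; rewrite /alt -signr_odd odd_double mul1r. Qed.

Lemma normr_altB n f s t : `|alt n f s - alt n f t| = `|f s - f t|.
Proof. by rewrite /alt -mulrBr normrMsign. Qed.

Lemma total_variation_alt n a s f :
  total_variation a s (alt n f) = total_variation a s f.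
Proof.
elim: n => [|n IH]; last by rewrite altS total_variationN.
by rewrite -[0%N]/(0.*2) alt_double.
Qed.

(** The sequence T_{U,0}, T_{D,0}, T_{U,1}, T_{D,1}, ... *)
Fixpoint switch_time a b c f n : \bar R :=
  if n is m.+1 then next_drop b c (alt m f) (switch_time a b c f m)
  else rise_time b c f a%:E.

Lemma switch_time_double a b c f k : switch_time a b c f k.*2 = TU a b c f k.
Proof.
elim: k => // k IH; rewrite doubleS /= IH altS alt_double.
by rewrite next_riseE.
Qed.

Lemma switch_time_doubleS a b c f k : switch_time a b c f k.*2.+1 = TD a b c f k.
Proof. by rewrite /= switch_time_double alt_double. Qed.

Lemma le_switch_time a b c f m n : (m <= n)%N ->
  (switch_time a b c f m <= switch_time a b c f n)%E.
Proof.
apply: (@homo_leq _ (switch_time a b c f) (fun u v => u <= v)%E) => //.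
  by move=> u v w; exact: le_trans.
by move=> k; exact: next_drop_ge.
Qed.

(** With the rising and the falling clauses merged into one indexed by [n], the
    clauses exclude each other because [switch_time] is nondecreasing. *)
Lemma fc_pieceP a b c f s y : fc_piece a b c f s y <->
  ((s%:E < switch_time a b c f 0)%E /\
     y = inf [set f t | t in [set t | a <= t <= b /\ (t%:E < switch_time a b c f 0)%E]]
         + c / 2) \/
  exists n, (switch_time a b c f n <= s%:E < switch_time a b c f n.+1)%E /\
     (-1) ^+ n * y = sup_from (alt n f) (switch_time a b c f n) s - c / 2.
Proof.
split=> [[first|[k [ph ->]]|[k [ph ->]]]|[first|[n [ph yE]]]].
- by left.
- right; exists k.*2; rewrite switch_time_double switch_time_doubleS alt_double.
  by rewrite -signr_odd odd_double mul1r.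
- right; exists k.*2.+1.
  rewrite switch_time_doubleS -doubleS switch_time_double altS alt_double.
  rewrite -signr_odd/= odd_double /= expr1 mulN1r inf_from_sup_from.
  by rewrite opprD opprK.
- by constructor 1.
move: ph yE; rewrite -[n]odd_double_half; case: (odd n); rewrite ?add0n ?add1n.
  rewrite switch_time_doubleS -doubleS switch_time_double altS alt_double.
  rewrite -signr_odd/= odd_double /= expr1 mulN1r => ph yE.
  constructor 3; exists n./2; split => //.
  by rewrite inf_from_sup_from; lra.
rewrite switch_time_double switch_time_doubleS alt_double.
rewrite -signr_odd odd_double mul1r => ph yE.
by constructor 2; exists n./2.
Qed.

Lemma fc_piece_unique a b c f s y z :
  fc_piece a b c f s y -> fc_piece a b c f s z -> y = z.
Proof.
have before n : (s%:E < switch_time a b c f 0)%E ->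
    ~~ (switch_time a b c f n <= s%:E < switch_time a b c f n.+1)%E.
  move=> s0; apply/negP => /andP[ns _].
  by have := le_trans (le_switch_time a b c f (leq0n n)) ns; rewrite leNgt s0.
have after m n : (m < n)%N ->
    (switch_time a b c f m <= s%:E < switch_time a b c f m.+1)%E ->
    ~~ (switch_time a b c f n <= s%:E < switch_time a b c f n.+1)%E.
  move=> mn /andP[_ sm]; apply/negP => /andP[ns _].
  by have := le_trans (le_switch_time a b c f mn) ns; rewrite leNgt sm.
move=> /fc_pieceP[[s0 ->]|[m [ms yE]]] /fc_pieceP[[s0' ->]|[n [ns zE]]] //.
- by have := before n s0; rewrite ns.
- by have := before m s0'; rewrite ms.
case: (ltngtP m n) => [mn|nm|mn].
- by have := after _ _ mn ms; rewrite ns.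
- by have := after _ _ nm ns; rewrite ms.
by subst n; apply: (can_inj (signrMK m)); rewrite yE zE.
Qed.

Lemma fc_up_of_piece a b c f s y : fc_piece a b c f s y -> fc_up a b c f s = y.
Proof. by move=> sy; apply: xget_unique => // z sz; apply: fc_piece_unique sz sy. Qed.

Lemma fc_up_initial a b c f s : (s%:E < switch_time a b c f 0)%E -> fc_up a b c f s =
  inf [set f t | t in [set t | a <= t <= b /\ (t%:E < switch_time a b c f 0)%E]] + c / 2.
Proof. by move=> s0; apply: fc_up_of_piece; apply/fc_pieceP; left. Qed.

Lemma alt_fc_up a b c f n s :
  (switch_time a b c f n <= s%:E < switch_time a b c f n.+1)%E ->
  alt n (fc_up a b c f) s = sup_from (alt n f) (switch_time a b c f n) s - c / 2.
Proof.
move=> ph; rewrite /alt (@fc_up_of_piece a b c f s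
  ((-1) ^+ n * (sup_from (alt n f) (switch_time a b c f n) s - c / 2))) ?signrMK //.
by apply/fc_pieceP; right; exists n; rewrite signrMK.
Qed.

End alternation.

Section switching_times.
Context {R : realType}.
Variables (a b c : R) (f : R -> R) (M : R).
Hypotheses (hab : a < b) (hc : 0 < c) (hf : cadlag a b f).
Hypothesis fM : forall t, a <= t <= b -> `|f t| <= M.

Let alt_le n t : a <= t <= b -> alt n f t <= M.
Proof.
move=> tab; apply: (le_trans (ler_norm _)).
by rewrite /alt normrMsign fM.
Qed.

Let alt_right_cvg n s : a <= s < b -> alt n f t @[t --> s^'+] --> alt n f s.
Proof. by move=> sab; apply: cvgMr; apply: hf.1. Qed.

Lemma switch_time0_attained : (switch_time a b c f 0 < +oo)%E ->
  exists y, [/\ switch_time a b c f 0 = y%:E, a < y, y <= b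
              & c <= sup_from (\- f) a%:E y + f y].
Proof.
rewrite /= rise_timeE => fin.
have [||||y [-> ay yb cy]] := @drop_time_attained _ b c (\- f) M a _ _ _ _ fin => //.
- exact: ltW.
- by move=> u; have := @alt_le 1 u; rewrite -[1%N]/((0.*2).+1) altS alt_double.
- by move=> u; have := @alt_right_cvg 1 u; rewrite -[1%N]/((0.*2).+1) altS alt_double.
by exists y; split => //; rewrite opprK in cy.
Qed.

Lemma switch_timeS_attained n x : switch_time a b c f n = x%:E -> a <= x ->
  (switch_time a b c f n.+1 < +oo)%E ->
  exists y, [/\ switch_time a b c f n.+1 = y%:E, x < y, y <= b
              & c <= sup_from (alt n f) x%:E y - alt n f y].
Proof.
move=> nx ax; rewrite [switch_time _ _ _ _ n.+1]/= nx.
apply: (next_drop_attained (M := M)) => //.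
- by move=> u /andP[xu ub]; apply: alt_le; rewrite (le_trans ax).
- by move=> u /andP[xu ub]; apply: alt_right_cvg; rewrite (le_trans ax).
Qed.

Lemma switch_time_real n : (switch_time a b c f n < +oo)%E ->
  exists x, [/\ switch_time a b c f n = x%:E, a < x & x <= b].
Proof.
elim: n => [|n IH] fin.
  by have [y [yE ay yb _]] := switch_time0_attained fin; exists y.
have [|x [nx ax xb]] := IH.
  by apply: le_lt_trans fin; exact: le_switch_time.
have [y [-> xy yb _]] := switch_timeS_attained nx (ltW ax) fin.
by exists y; split => //; apply: lt_trans xy.
Qed.

Lemma lt_switch_timeS n x : switch_time a b c f n = x%:E -> a <= x ->
  (x%:E < switch_time a b c f n.+1)%E.
Proof.
move=> nx ax; have [->|fin] := eqVneq (switch_time a b c f n.+1) +oo%E.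
  by rewrite ltry.
have [|y [-> xy _ _]] := switch_timeS_attained nx ax; first by rewrite ltey.
by rewrite lte_fin.
Qed.

(** If no phase contains [s], all switching times are at most [s] and increase
    to some [L].  Between two consecutive ones [f] moves by at least [c], which
    contradicts the existence of the left limit at [L]. *)
Lemma phase_cover s : s <= b -> (s%:E < switch_time a b c f 0)%E \/
  exists n x, [/\ switch_time a b c f n = x%:E, a < x, x <= s
    & (s%:E < switch_time a b c f n.+1)%E].
Proof.
move=> sb; apply: contrapT => /not_orP[/negP]; rewrite -leNgt => s0 nph.
have tau_s n : (switch_time a b c f n <= s%:E)%E.
  elim: n => // n ns; rewrite leNgt; apply/negP => sn; apply: nph.
  have [|x [nx ax xb]] := @switch_time_real n; first by rewrite (le_lt_trans ns) ?ltry.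
  by exists n, x; split => //; rewrite -lee_fin -nx.
have fin n : (switch_time a b c f n < +oo)%E by rewrite (le_lt_trans (tau_s n)) ?ltry.
pose r n := fine (switch_time a b c f n).
have rE n : switch_time a b c f n = (r n)%:E.
  by rewrite /r; have [x [-> _ _]] := switch_time_real (fin n).
have ar n : a < r n by have [x []] := switch_time_real (fin n); rewrite rE => -[->].
have rs n : r n <= s by rewrite -lee_fin -rE.
have step n : r n < r n.+1 /\
    c <= sup_from (alt n f) (r n)%:E (r n.+1) - alt n f (r n.+1).
  have [y []] := switch_timeS_attained (rE n) (ltW (ar n)) (fin n.+1).
  by rewrite rE => -[->].
pose L := sup (range r).
have rub : has_ubound (range r) by exists s => _ [n _ <-].
have rL n : r n < L.
  by apply: (lt_le_trans (step n).1); apply: ub_le_sup => //; exists n.+1.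
have Lb : L <= b.
  apply: le_trans sb; apply: ge_sup; first by exists (r 0%N), 0%N.
  by move=> _ [n _ <-].
have c3 : 0 < c / 3 by rewrite divr_gt0.
have aLb : a < L <= b by rewrite Lb (lt_trans (ar 0%N)).
have /cvgrPdist_lt/(_ _ c3) := hf.2 _ aLb.
set l := lim _; rewrite near_withinE => /nbhs_ballP[e /= e0 H].
have {H}near_l t : L - e < t -> t < L -> `|f t - l| < c / 3.
  by move=> ? tL; rewrite distrC; apply: H => //; rewrite /ball /= ger0_norm; lra.
have [_ [n _ <-] rn] : exists2 u, range r u & L - e < u.
  by apply: sup_adherent => //; split => //; exists (r 0%N), 0%N.
have [rnS cn] := step n.
have close t : r n <= t -> t <= r n.+1 -> `|alt n f t - (-1) ^+ n * l| < c / 3.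
  move=> nt tn; rewrite /alt -mulrBr normrMsign; apply: near_l; first by lra.
  exact: le_lt_trans (rL n.+1).
have : sup_from (alt n f) (r n)%:E (r n.+1) <= (-1) ^+ n * l + c / 3.
  apply: sup_from_le; first exact: ltW.
  by move=> t /andP[nt tn]; have := close _ nt tn; rewrite ltr_norml => /andP[]; lra.
have := close _ (ltW rnS) (lexx _); rewrite ltr_norml => /andP[]; lra.
Qed.

End switching_times.

(** * Comparing variations phase by phase *)

Section certificates.
Context {R : realType}.
Variables (a b c M : R) (W : R -> R).
Implicit Types (x y s t B : R) (F G h : R -> R).

(** [W] grows at least as fast as the total variation of [G]; equivalently,
    [W - G] and [W + G] are nondecreasing. *)
Definition controls G := forall s t, a <= s -> s <= t -> t <= b ->
  `|G t - G s| <= W t - W s.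

(** [B] separates [V - h], where [V] is the variation of [h] from [a], from
    [W - G]: these differences only grow when [h], respectively [G], decreases,
    so that, up to a constant, they are twice the negative variations. *)
Definition certificate G h x B :=
  (forall t, x <= t <= b -> B <= W t - G t) /\
  (total_variation a x h <= (B + h x)%:E)%E.

Section phase.
Variables (F G h : R -> R) (x B : R).
Hypotheses (ax : a <= x) (WG : controls G).
Hypothesis FM : forall t, x <= t <= b -> F t <= M.
Hypothesis FG : forall t, x <= t <= b -> F t - c / 2 <= G t.
Hypothesis xB : certificate G h x B.

(** The next constant is [B' = B + 2 m], where [m] is the supremum of [h] over
    the phase.  For [G] it works because [G u >= F u - c / 2] is near [m] or
    above it for some [u] in the phase, and [W + G = (W - G) + 2 G] is
    nondecreasing.  For [h] it works because [h] is nondecreasing on the phase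
    and ends by jumping to [F y + c / 2 <= m]. *)
Lemma certificate_at_drop y : 0 < c -> x < y -> y <= b ->
  (forall s, x <= s < y -> h s = sup_from F x%:E s - c / 2) ->
  h y = F y + c / 2 -> c <= sup_from F x%:E y - F y ->
  exists B', certificate (\- G) (\- h) y B'.
Proof.
move=> c0 xy yb hE hy cy.
pose m := sup [set F t | t in [set t | x <= t < y]] - c / 2.
have Fm t : x <= t < y -> F t <= m + c / 2.
  move=> xty; rewrite /m subrK; apply: ub_le_sup; last by exists t.
  exists M => _ [u /= /andP[xu uy] <-]; apply: FM.
  by rewrite xu ltW // (lt_le_trans uy).
have m_le k : (forall t, x <= t < y -> F t <= k + c / 2) -> m <= k.
  move=> Fk; rewrite /m lerBlDr; apply: ge_sup.
    by exists (F x), x => //=; rewrite lexx.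
  by move=> _ [t xty <-]; exact: Fk.
(* at [y] this uses that [F] has dropped by [c] there *)
have hm s : x <= s -> s <= y -> h s <= m.
  move=> xs; rewrite le_eqVlt => /predU1P[->|sy].
    have : sup_from F x%:E y <= Num.max (m + c / 2) (F y).
      apply: sup_from_le => [|t /andP[xt]]; first exact: ltW.
      rewrite le_max le_eqVlt => /predU1P[->|ty]; first by rewrite lexx orbT.
      by rewrite Fm ?xt.
    by rewrite hy le_max => /orP[]; lra.
  rewrite hE ?xs// lerBlDr; apply: sup_from_le => // t /andP[xt ts].
  by rewrite Fm // xt (le_lt_trans ts).
have incr s t : x <= s -> s <= t -> t < y -> h s <= h t.
  move=> xs st ty; rewrite !hE ?xs ?(le_trans xs)//; last exact: le_lt_trans ty.
  rewrite lerB // ; apply: sup_from_le => // u /andP[xu us].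
  by apply: (sup_from_ge FM); rewrite ?xu ?(le_trans us)// (le_trans (ltW ty)).
exists (B + 2 * m); split.
  move=> t /andP[yt tb].
  suff : m <= (W t + G t - B) / 2 by rewrite /=; lra.
  apply: m_le => u /andP[xu uy].
  have ut : u <= t by rewrite ltW // (lt_le_trans uy).
  have := WG (le_trans ax xu) ut tb.
  have := xB.1 u; have := @FG u; rewrite xu (le_trans ut tb) => /(_ isT) ? /(_ isT) ?.
  by rewrite ler_norml => /andP[]; lra.
rewrite total_variationN (total_variationD _ ax (ltW xy)).
apply: le_trans (leeD xB.2 (total_variation_peak xy incr hm)) _.
by rewrite -EFinD lee_fin /=; lra.
Qed.

Variable s : R.
Hypotheses (xs : x <= s) (sb : s <= b).
Hypothesis hE : forall t, x <= t <= s -> h t = sup_from F x%:E t - c / 2.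

Let h_ge t : x <= t <= s -> F t - c / 2 <= h t.
Proof.
move=> /andP[xt ts]; rewrite hE ?xt// lerB//; apply: (sup_from_ge FM).
  by rewrite xt /=.
exact: le_trans sb.
Qed.

Let h_le t k : x <= t <= s -> (forall u, x <= u <= t -> F u - c / 2 <= k) -> h t <= k.
Proof.
move=> /andP[xt ts] Fk; rewrite hE ?xt// lerBlDr; apply: sup_from_le => // u xut.
by rewrite -lerBlDr; exact: Fk.
Qed.

Lemma phase_total_variation : (total_variation a s h <= (B + h s)%:E)%E.
Proof.
rewrite (total_variationD _ ax xs) (nondecreasing_total_variation xs).
  by apply: (le_trans (leeD xB.2 (lexx _))); rewrite -EFinD lee_fin; lra.
move=> t u; rewrite !in_itv /= => /andP[xt ts] /andP[xu us] tu.
apply: h_le; first by rewrite xt.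
move=> v /andP[xv vt]; rewrite hE ?xu//.
by rewrite lerB//; apply: (sup_from_ge FM); rewrite ?xv ?(le_trans vt)// (le_trans us).
Qed.

(** For [u] in [[x; t]], [W t >= W u >= B + G u >= B + F u - c / 2]; the supremum
    over [u] of the right-hand side is [B + h t]. *)
Lemma phase_le_controller t : x <= t <= s -> B + h t <= W t.
Proof.
move=> /andP[xt ts]; rewrite -lerBrDl; apply: h_le; first by rewrite xt.
move=> u /andP[xu ut].
have tb := le_trans ts sb; have ub := le_trans ut tb.
have := xB.1 u; have := @FG u; rewrite xu ub => /(_ isT) ? /(_ isT) ?.
have := le_trans (normr_ge0 _) (WG (le_trans ax xu) ut tb); lra.
Qed.

(** [G s <= h s] is [B <= W s - G s].  Conversely, at some [t <= s] both [G t] and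
    [h t] are near [h s] or above it, and then [W s - W t <= h s - h t] leaves
    too little variation for [G] to end below [h s]. *)
Lemma phase_unique : W s <= B + h s -> G s = h s.
Proof.
move=> Ws; apply/eqP; rewrite eq_le; apply/andP; split.
  by have := xB.1 s; rewrite xs sb => /(_ isT); lra.
(* this bound lets [F t - c / 2] estimate [G t] and [h t] at the same time *)
suff : h s <= (G s + h s) / 2 by lra.
apply: h_le; first by rewrite xs lexx.
move=> t /andP[xt ts]; have xts : x <= t <= s by rewrite xt.
have := WG (le_trans ax xt) ts sb; rewrite ler_norml => /andP[? _].
have := phase_le_controller xts; have := h_ge xts.
have := @FG t; rewrite xt (le_trans ts sb) => /(_ isT); lra.
Qed.

End phase.
End certificates.

(** * Optimality and uniqueness of the construction *)

Section optimality_of_fc_up.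
Context {R : realType}.
Variables (a b c : R) (f g : R -> R).
Hypotheses (hab : a < b) (hc : 0 < c) (hf : cadlag a b f).
Hypothesis fg : forall t, a <= t <= b -> `|f t - g t| <= c / 2.
Hypothesis hg : (total_variation a b g < +oo)%E.

Let W t := fine (total_variation a t g).
Let h := fc_up a b c f.
Let tau := switch_time a b c f.
Let M : R := `|g a| + W b + c / 2.
(* the value of [h] on the initial piece *)
Let kappa : R := inf [set f t | t in [set t | a <= t <= b /\ (t%:E < tau 0)%E]] + c / 2.

Let TVE t : a <= t <= b -> total_variation a t g = (W t)%:E.
Proof.
move=> /andP[at_ tb]; rewrite /W fineK // ge0_fin_numE ?total_variation_ge0//.
apply: le_lt_trans hg; rewrite (total_variationD _ at_ tb).
by rewrite leeDl // total_variation_ge0.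
Qed.

Let Wa : W a = 0.
Proof. by rewrite /W total_variationxx. Qed.

Let Wg : controls a b W g.
Proof.
move=> s t as_ st tb; have /= := total_variation_ge g st.
have := total_variationD g as_ st.
rewrite !TVE ?as_ ?(le_trans st tb) ?(le_trans as_ st) ?tb//.
case: (total_variation s t g) => [r| |] //.
by rewrite -EFinD lee_fin => -[->]; lra.
Qed.

Let Walt n : controls a b W (alt n g).
Proof. by move=> s t as_ st tb; rewrite normr_altB; exact: Wg. Qed.

Let fM t : a <= t <= b -> `|f t| <= M.
Proof.
move=> /andP[at_ tb]; have := @fg t; rewrite at_ tb => /(_ isT).
have := Wg (lexx a) at_ tb; have := le_trans (normr_ge0 _) (Wg at_ tb (lexx b)).
rewrite Wa /M !ler_norml => ? /andP[? ?] /andP[? ?].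
have := ler_norm (g a); have := ler_norm (- g a); rewrite normrN => ? ?.
by apply/andP; split; lra.
Qed.

Let altM n t : a <= t <= b -> alt n f t <= M.
Proof.
by move=> /fM; rewrite /alt; apply: le_trans; rewrite -(normrMsign n) ler_norm.
Qed.

Let alt_fg n t : a <= t <= b -> alt n f t - c / 2 <= alt n g t.
Proof.
move=> /fg H; have : alt n f t - alt n g t <= c / 2.
  by apply: le_trans H; rewrite /alt -mulrBr -(normrMsign n) ler_norm.
lra.
Qed.

Let kappa_le t : a <= t -> t <= b -> (t%:E < tau 0)%E -> kappa <= f t + c / 2.
Proof.
move=> at_ tb t0; rewrite lerD2r; apply: ge_inf.
  exists (- M) => _ [u /= [uab _] <-].
  by have := fM uab; rewrite ler_norml => /andP[].
by exists t => //=; rewrite at_.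
Qed.

Let a_lt_tau0 : (a%:E < tau 0)%E.
Proof.
have [->|fin] := eqVneq (tau 0) +oo%E; first by rewrite ltry.
have [|y [yE ay _ _]] := switch_time0_attained hab hc hf fM; first by rewrite ltey.
by rewrite /tau yE lte_fin.
Qed.

Let le_kappa (k : R) :
  (forall t, a <= t -> t <= b -> (t%:E < tau 0)%E -> k <= f t + c / 2) ->
  k <= kappa.
Proof.
move=> kf; rewrite -lerBlDr; apply: lb_le_inf.
  by exists (f a), a => //=; rewrite lexx ltW.
by move=> _ [t /= [/andP[at_ tb] t0] <-]; rewrite lerBlDr; exact: kf.
Qed.

Let h_initial s : (s%:E < tau 0)%E -> h s = kappa.
Proof. exact: fc_up_initial. Qed.

Let h_phase n x s : tau n = x%:E -> x <= s -> (s%:E < tau n.+1)%E ->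
  alt n h s = sup_from (alt n f) x%:E s - c / 2.
Proof.
by move=> nx xs sS; rewrite -nx; apply: alt_fc_up; rewrite -/tau nx lee_fin xs.
Qed.

Let initial_total_variation s : a <= s -> s <= b -> (s%:E < tau 0)%E ->
  total_variation a s h = 0%E.
Proof.
move=> as_ sb s0.
have hk t : a <= t <= s -> h t = kappa.
  by move=> /andP[_ ts]; rewrite h_initial //; apply: le_lt_trans s0; rewrite lee_fin.
rewrite nondecreasing_total_variation // ?hk ?lexx ?as_ ?subrr//.
by move=> t u; rewrite !in_itv /= => ts us _; rewrite !hk.
Qed.

(** The infimum of [f] over [[a; y]] is not taken at [y], where [f] has risen by
    [c] above it, so it is already the infimum over [[a; y)]. *)
Let tau0_jump y : tau 0 = y%:E -> a < y -> y <= b ->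
  c <= sup_from (\- f) a%:E y + f y -> h y = f y - c / 2 /\ kappa <= h y.
Proof.
move=> y0 ay yb cy.
have -> : h y = f y - c / 2.
  have yS : (y%:E < tau 1)%E by apply: (lt_switch_timeS hc hf fM y0 (ltW ay)).
  by have := h_phase y0 (lexx y) yS; rewrite -[0%N]/(0.*2) !alt_double sup_from_self.
split=> //.
have : sup_from (\- f) a%:E y <= Num.max (c / 2 - kappa) (- f y).
  apply: sup_from_le => [|t /andP[at_]]; first exact: ltW.
  rewrite le_max le_eqVlt => /predU1P[->|ty]; first by rewrite lexx orbT.
  have := @kappa_le t at_ (le_trans (ltW ty) yb); rewrite y0 lte_fin ty => /(_ isT) ?.
  by apply/orP; left; rewrite /=; lra.
rewrite le_max => /orP[|]; move: hc; lra.
Qed.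

Let initial_jump y : tau 0 = y%:E -> a < y -> y <= b -> kappa <= h y ->
  (total_variation a y h <= (- kappa + h y)%:E)%E.
Proof.
move=> y0 ay yb ky.
have hk t : t < y -> h t = kappa by move=> ty; rewrite h_initial // y0 lte_fin.
rewrite nondecreasing_total_variation ?(ltW ay)//.
  by rewrite (hk a ay) lee_fin; lra.
move=> t u; rewrite !in_itv /= => /andP[_ ty] /andP[_ uy] tu.
move: uy; rewrite le_eqVlt => /predU1P[uy|uy]; last first.
  by rewrite !hk //; apply: le_lt_trans uy.
move: ty; rewrite le_eqVlt => /predU1P[ty|ty]; first by rewrite uy ty.
by rewrite uy hk.
Qed.

Let certificate_exists n x : tau n = x%:E ->
  exists B, certificate a b W (alt n g) (alt n h) x B.
Proof.
elim: n x => [|n IH] y yE.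
  have [|z [zE ay yb cy]] := switch_time0_attained hab hc hf fM.
    by rewrite -/tau yE ltry.
  move: zE; rewrite -/tau yE => -[zE]; subst z.
  have [_ ky] := tau0_jump yE ay yb cy.
  rewrite -[0%N]/(0.*2) !alt_double.
  (* on the initial piece [V - h = - kappa], and an upward jump preserves this *)
  exists (- kappa); split; last exact: initial_jump.
  move=> t /andP[yt tb]; rewrite lerNl; apply: le_kappa => u au ub.
  rewrite yE lte_fin => uy.
  have := @fg u; rewrite au ub => /(_ isT).
  have := Wg au (ltW (lt_le_trans uy yt)) tb.
  have := le_trans (normr_ge0 _) (Wg (lexx a) au ub).
  by rewrite Wa !ler_norml => ? /andP[? ?] /andP[? ?]; lra.
have fin : (tau n.+1 < +oo)%E by rewrite yE ltry.
have [|x [nx ax xb]] := @switch_time_real _ a b c f M hab hc hf fM n.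
  by apply: le_lt_trans fin; exact: le_switch_time.
have [z] := switch_timeS_attained hc hf fM nx (ltW ax) fin.
rewrite -/tau yE => -[[zE] xy yb cy]; subst z.
have [B xB] := IH _ nx.
rewrite !altS; apply: (certificate_at_drop (F := alt n f) (c := c) (M := M) (x := x)
  (B := B)) => //.
- exact: ltW.
- by move=> t /andP[xt tb]; rewrite altM // (le_trans (ltW ax)).
- by move=> t /andP[xt tb]; rewrite alt_fg // (le_trans (ltW ax)).
- move=> s /andP[xs sy]; apply: h_phase => //; by rewrite yE lte_fin.
(* at [y] itself the next phase has just begun *)
have yS : (y%:E < tau n.+2)%E.
  exact: (lt_switch_timeS hc hf fM yE (ltW (lt_trans ax xy))).
by have := h_phase yE (lexx y) yS; rewrite sup_from_self !altS /=; lra.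
Qed.

(** What the certificates give at a single point: whichever phase [s] lies in,
    some [B + alt n h s] separates the two variations, and [g] is determined
    where they meet. *)
Let phase_separation s : a <= s -> s <= b -> ~~ (s%:E < tau 0)%E ->
  exists n B, [/\ (total_variation a s h <= (B + alt n h s)%:E)%E,
    B + alt n h s <= W s & W s <= B + alt n h s -> g s = h s].
Proof.
move=> as_ sb s0; have [s0'|[n [x [nx ax xs sS]]]] := phase_cover hab hc hf fM sb.
  by rewrite s0' in s0.
have [B xB] := certificate_exists nx.
have FM t : x <= t <= b -> alt n f t <= M.
  by move=> /andP[xt tb]; rewrite altM // (le_trans (ltW ax)).
have FG t : x <= t <= b -> alt n f t - c / 2 <= alt n g t.
  by move=> /andP[xt tb]; rewrite alt_fg // (le_trans (ltW ax)).
have hE t : x <= t <= s -> alt n h t = sup_from (alt n f) x%:E t - c / 2.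
  move=> /andP[xt ts]; apply: h_phase => //.
  by apply: le_lt_trans sS; rewrite lee_fin.
exists n, B; split.
- rewrite -(total_variation_alt n a s h).
  exact: (phase_total_variation (ltW ax) FM xB xs sb hE).
- by apply: (phase_le_controller (ltW ax) (@Walt n) FG xB sb hE); rewrite xs lexx.
- move/(phase_unique (ltW ax) (@Walt n) FM FG xB xs sb hE).
  exact: (can_inj (signrMK n)).
Qed.

Lemma fc_up_total_variation_le s : a <= s -> s <= b ->
  (total_variation a s h <= total_variation a s g)%E.
Proof.
move=> as_ sb; have [s0|s0] := boolP (s%:E < tau 0)%E.
  by rewrite initial_total_variation // total_variation_ge0.
have [n [B [Vs Ws _]]] := phase_separation as_ sb s0.
by apply: (le_trans Vs); rewrite TVE ?as_ // lee_fin.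
Qed.

Lemma fc_up_unique :
  (forall s, a <= s -> s <= b ->
     (total_variation a s g <= total_variation a s h)%E) ->
  (c%:E <= oscillation a b f)%E ->
  forall s, a <= s -> s <= b -> g s = h s.
Proof.
move=> gh osc s as_ sb; have [s0|s0] := boolP (s%:E < tau 0)%E; last first.
  have [n [B [Vs _ gE]]] := phase_separation as_ sb s0; apply: gE.
  by rewrite -lee_fin -TVE ?as_ //; exact: le_trans (gh _ as_ sb) Vs.
rewrite h_initial //.
have g_const t : a <= t -> t <= b -> (t%:E < tau 0)%E -> g t = g a.
  move=> at_ tb t0; have := gh t at_ tb.
  rewrite initial_total_variation // TVE ?at_ // lee_fin.
  have := Wg (lexx a) at_ tb; rewrite Wa ler_norml => /andP[? ?] ?.
  by lra.
rewrite g_const //; apply/eqP; rewrite eq_le; apply/andP; split.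
  apply: le_kappa => t at_ tb t0; rewrite -(g_const t at_ tb t0).
  by have := @fg t; rewrite at_ tb ler_norml => /(_ isT) /andP[? ?]; lra.
have [t0oo|fin] := eqVneq (tau 0) +oo%E; last first.
  (* [g] must climb from [g a] to [h y] within the variation [h y - kappa] *)
  have [|y [yE ay yb cy]] := switch_time0_attained hab hc hf fM; first by rewrite ltey.
  have [hy ky] := tau0_jump yE ay yb cy.
  have := le_trans (gh y (ltW ay) yb) (initial_jump yE ay yb ky).
  rewrite TVE ?(ltW ay)// lee_fin.
  have := Wg (lexx a) (ltW ay) yb; rewrite Wa ler_norml => /andP[_ ?].
  have := @fg y; rewrite (ltW ay) yb ler_norml => /(_ isT) /andP[? ?].
  lra.
have fk t : a <= t <= b -> kappa - c / 2 <= f t <= g a + c / 2.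
  move=> /andP[at_ tb]; have t0 : (t%:E < tau 0)%E by rewrite t0oo ltry.
  have := kappa_le at_ tb t0.
  have := @fg t; rewrite at_ tb ler_norml => /(_ isT) /andP[? ?].
  have := g_const t at_ tb t0 => ? ?; apply/andP; split; lra.
(* the values of [f] lie in an interval of that length *)
suff : c <= g a + c / 2 - (kappa - c / 2) by lra.
rewrite -lee_fin; apply: le_trans osc _.
apply: ge_ereal_sup => _ [[u v] /= [uab vab] <-].
move: uab vab; rewrite !in_itv /= => /fk/andP[? ?] /fk/andP[? ?].
by rewrite lee_fin ler_norml; apply/andP; split; lra.
Qed.

End optimality_of_fc_up.

Lemma sup_norm_le {R : realType} (a b e : R) h t :
  (sup_norm a b h <= e%:E)%E -> a <= t <= b -> `|h t| <= e.
Proof.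
move=> he tab; rewrite -lee_fin; apply: le_trans he.
by apply: ereal_sup_ubound; exists t => //=; rewrite in_itv.
Qed.

Lemma cadlagN {R : realType} (a b : R) f : cadlag a b f -> cadlag a b (\- f).
Proof.
move=> [fr fl]; split=> s sab; first by apply: cvgN; exact: fr.
by apply: is_cvgN; exact: fl.
Qed.

Lemma oscillationN {R : realType} (a b : R) f :
  oscillation a b (\- f) = oscillation a b f.
Proof.
by congr (ereal_sup [set _ | x in _]); apply/funext => x /=; rewrite -opprD normrN.
Qed.

Theorem corollary2p1 (R : realType) (a b c : R) (f g : R -> R)
    (hab : a < b) (hc : 0 < c) (hf : cadlag a b f)
    (hfg : (sup_norm a b (f \- g)%R <= (c / 2)%:E)%E)
    (hg : (total_variation a b g < +oo)%E) :
  (forall s : R, a <= s <= b ->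
     (total_variation a s (fc a b c f) <= total_variation a s g)%E) /\
  ((forall s : R, a <= s <= b ->
      (total_variation a s g <= total_variation a s (fc a b c f))%E) ->
   (c%:E <= oscillation a b f)%E ->
   forall s : R, a <= s <= b -> g s = fc a b c f s).
Proof.
have fg t : a <= t <= b -> `|f t - g t| <= c / 2 := sup_norm_le hfg.
rewrite /fc; case: ifP => _.
  split=> [s /andP[as_ sb]|gh osc s /andP[as_ sb]].
    exact: fc_up_total_variation_le.
  by apply: fc_up_unique => // t at_ tb; apply: gh; rewrite at_.
have Nfg t : a <= t <= b -> `|(\- f) t - (\- g) t| <= c / 2.
  by move=> /fg; rewrite -opprD normrN.
have Nhg : (total_variation a b (\- g)%R < +oo)%E by rewrite total_variationN.
have Nhf := cadlagN hf.
split=> [s /andP[as_ sb]|gh osc s /andP[as_ sb]].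
  by rewrite total_variationN -[leRHS]total_variationN; exact: fc_up_total_variation_le.
apply: oppr_inj; rewrite opprK -[- g s]/((\- g) s).
apply: (fc_up_unique hab hc Nhf Nfg Nhg) => // [t at_ tb|].
  by have := gh t; rewrite at_ tb !total_variationN => /(_ isT).
by rewrite oscillationN.
Qed.
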